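(* Let $d,m\ge 1$ be integers, $\pi\in(0,1)$, $\sigma>0$, $\delta\in(0,1)$, and let $\bar\nabla_{\mathrm{in}}\in\mathbb{R}^d$ be the fixed reference gradient. Let $G_1,\dots,G_m$ be the gradients of the wild samples under the Huber contamination model with contamination proportion $\pi$, with true InD index set $\mathcal{I}$ and $M_{\mathrm{in}}=|\mathcal{I}|$. Assume that the InD gradients $\{G_i\}_{i\in\mathcal{I}}$ are i.i.d. and that for each $i\in\mathcal I$ and each coordinate $j\in\{1,\dots,d\}$ the centered coordinate $G_{i,j}-\bar\nabla_{\mathrm{in},j}$ is sub-Gaussian with variance proxy $\sigma^2$. Set $\epsilon=\sigma\sqrt{2\log(4dm/\delta)}$. If $$m\ \ge\ \frac{2\log(2/\delta)}{(1-\pi)^2},$$ then, with probability at least $1-\delta$, the ideal filter $$\mathcal{S}^\star\in\arg\min_{\mathcal{S}\subseteq\{1,\dots,m\},\ |\mathcal{S}|=M_{\mathrm{in}}}\big\|\mathrm{EWM}(G_{\mathcal S})-\bar\nabla_{\mathrm{in}}\big\|_2$$ satisfies $$\mathrm{ERR}_{\mathrm{in}}:=\frac{|\mathcal{I}\setminus\mathcal{S}^\star|}{M_{\mathrm{in}}}\ \le\ \frac{2}{(1-\pi)^2}\sqrt{\frac{\log(2/\delta)}{2m}}+\frac{\pi}{1-\pi},$$ and moreover $$\big\|\mathrm{EWM}(G_{\mathcal S^\star})-\bar\nabla_{\mathrm{in}}\big\|_2\le\epsilon\sqrt d .$$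
   Context: Wild data and Huber contamination model: there are $m$ independent wild samples $\tilde x_1,\dots,\tilde x_m$ drawn from $\mathbb{P}_{\mathrm{wild}}=(1-\pi)\mathbb{P}_{\mathrm{in}}+\pi\mathbb{P}_{\mathrm{out}}$, where $\mathbb{P}_{\mathrm{in}},\mathbb{P}_{\mathrm{out}}$ are probability distributions on an input space $\mathcal X$: independently for each $i$, sample $i$ is in-distribution (InD, drawn from $\mathbb{P}_{\mathrm{in}}$) with probability $1-\pi$ and out-of-distribution (OOD, drawn from $\mathbb{P}_{\mathrm{out}}$) with probability $\pi$. This partitions the index set $\{1,\dots,m\}$ (identified with $\mathcal{S}_{\mathrm{wild}}$) into the random true InD subset $\mathcal I$ and true OOD subset $\mathcal O$, of random sizes $M_{\mathrm{in}}=|\mathcal I|$ and $M_{\mathrm{out}}=|\mathcal O|$, with $M_{\mathrm{in}}+M_{\mathrm{out}}=m$ and $M_{\mathrm{in}}\sim\mathrm{Bin}(m,1-\pi)$. Gradients: $G_i=\nabla\ell(f(\tilde x_i),\hat y_{\tilde x_i})\in\mathbb{R}^d$ is the loss gradient (with respect to model parameters) of wild sample $i$ for a fixed, already trained classifier $f$, where $\hat y_{\tilde x_i}$ is the label predicted by $f$; for the purposes of the statement, $G_i$ is a fixed measurable function of $\tilde x_i$. $G_{i,j}$ is the $j$-th coordinate of $G_i$. The reference gradient $\bar\nabla_{\mathrm{in}}\in\mathbb{R}^d$ (the mean loss gradient over a separate labeled InD training set) is a fixed, non-random vector, with $j$-th coordinate $\bar\nabla_{\mathrm{in},j}$. Distributional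 assumptions on $\{G_i\}_{i\in\mathcal I}$ are understood conditionally on the InD/OOD labels of the samples. Element-wise median: for a nonempty $\mathcal S\subseteq\{1,\dots,m\}$, $G_{\mathcal S}=\{G_i\}_{i\in\mathcal S}$ and $\mathrm{EWM}(G_{\mathcal S})\in\mathbb{R}^d$ is the vector whose $j$-th coordinate is the median of the numbers $\{G_{i,j}: i\in\mathcal S\}$ (for an even number of values, a fixed convention choosing a point between the two middle order statistics). Sub-Gaussian with variance proxy $\sigma^2$: a real random variable $X$ with $\mathbb{E}[e^{\lambda X}]\le e^{\lambda^2\sigma^2/2}$ for all $\lambda\in\mathbb{R}$. $\mathcal S^\star$ denotes any minimizer (ties broken arbitrarily). $\mathrm{ERR}_{\mathrm{in}}$ and the filter are defined only when $M_{\mathrm{in}}\ge1$; the event of probability at least $1-\delta$ is understood to be contained in $\{M_{\mathrm{in}}\ge 1\}$. *)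

(* Defs.v *)
From HB Require Import structures.
From mathcomp Require Export all_boot all_order all_algebra.
From mathcomp Require Export all_classical all_reals all_analysis.

Set Implicit Arguments.
Unset Strict Implicit.
Unset Printing Implicit Defensive.

Export Order.TTheory GRing.Theory Num.Theory.

#[global] Open Scope classical_set_scope.
#[global] Open Scope ring_scope.

Section probability.
Context d (T : measurableType d) (R : realType).

(* The law P( . | A); when P A = 0 it is P itself, the default of mnormalize. *)
Definition cond_prob (P : probability T R) (A : set T) (mA : measurable A)
  : probability T R := mnormalize (mrestr P mA) P.

Lemma cond_probE (P : probability T R) (A : set T) (mA : measurable A) B :
  P A != 0%E -> cond_prob P mA B = (P (B `&` A) * (fine (P A))^-1%:E)%E.
Proof.
move=> A0; have PT : mrestr P mA setT = P A by rewrite /mrestr setTI.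
have -> : cond_prob P mA B = (if (P A == 0%E) || (P A == +oo%E) then P B
    else P (B `&` A) * (fine (P A))^-1%:E)%E.
  by rewrite -PT /cond_prob /= /mnormalize; case: ifP.
by rewrite (negbTE A0)/= lt_eqF// (le_lt_trans (probability_le1 _ mA)) ?ltry.
Qed.

(* v is the variance proxy, i.e. the square of the scale. *)
Definition sub_gaussian (P : probability T R) (Y : T -> R) (v : R) : Prop :=
  forall t : R, ('M_P Y t <= (expR (t ^+ 2 * v / 2))%:E)%E.

Definition mutually_independent d' (U : measurableType d') (P : probability T R)
    (I : finType) (Y : I -> T -> U) : Prop :=
  forall (J : {set I}) (B : I -> set U), (forall i, measurable (B i)) ->
    P (\bigcap_(i in [set` J]) (Y i @^-1` B i))
    = (\prod_(i in J) P (Y i @^-1` B i))%E.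

End probability.

Section huber.
Context d (T : measurableType d) d' (X : measurableType d') (R : realType).
Variables (P : probability T R) (m : nat).
(* [ood i] is the hidden label of sample [x i]: true when drawn from Pout. *)
Variables (ood : 'I_m -> {RV P >-> bool}) (x : 'I_m -> {RV P >-> X}).

Record huber_model (Pin Pout : probability X R) (p : R) : Prop := HuberModel {
  huber_indep : mutually_independent P (fun i w => (ood i w, x i w));
  huber_in : forall i A, measurable A ->
    P [set w | ood i w = false /\ A (x i w)] = ((1 - p)%:E * Pin A)%E;
  huber_out : forall i A, measurable A ->
    P [set w | ood i w = true /\ A (x i w)] = (p%:E * Pout A)%E
}.

Definition inD (w : T) : {set 'I_m} := [set i | ~~ ood i w]%SET.

Definition labels_event (I : {set 'I_m}) : set T := [set w | inD w = I].

Lemma labels_eventE (I : {set 'I_m}) :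
  labels_event I = \bigcap_(i in [set: 'I_m]) (ood i @^-1` [set i \notin I]).
Proof.
apply/seteqP; split => w /=.
  by move=> <- i _ /=; rewrite inE negbK.
by move=> h; apply/setP => i; rewrite inE (h i Logic.I) negbK.
Qed.

Lemma measurable_labels_event (I : {set 'I_m}) : measurable (labels_event I).
Proof.
rewrite labels_eventE.
apply: fin_bigcap_measurable => [|i _]; first exact: finite_finset.
by rewrite -[X in measurable X]setTI; apply: measurable_funP.
Qed.

Definition given_labels (I : {set 'I_m}) : probability T R :=
  cond_prob P (measurable_labels_event I).

(* In the Huber model the in-distribution samples, hence also their images
   under any fixed measurable map, are i.i.d. given the labels. *)
Lemma inD_samples_iid (Pin Pout : probability X R) (p : R) :
  0 < p < 1 -> huber_model Pin Pout p ->
  forall (I : {set 'I_m}) (B : 'I_m -> set X), (forall i, measurable (B i)) ->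
  given_labels I (\bigcap_(i in [set` I]) (x i @^-1` B i))
  = (\prod_(i in I) Pin (B i))%E.
Proof.
case/andP => p0 p1 [indep hin hout] I B mB.
pose C (D : 'I_m -> set X) i : set (bool * X) :=
  [set i \notin I] `*` (if i \in I then D i else setT).
have key D : (forall i, measurable (D i)) ->
    P (labels_event I `&` \bigcap_(i in [set` I]) (x i @^-1` D i))
    = ((\prod_(i : 'I_m) (if i \in I then 1 - p else p))%:E
       * \prod_(i in I) Pin (D i))%E.
  move=> mD.
  have -> : labels_event I `&` \bigcap_(i in [set` I]) (x i @^-1` D i)
      = \bigcap_(i in [set` [set: 'I_m]%SET])
          ((fun w => (ood i w, x i w)) @^-1` C D i).
    rewrite labels_eventE; apply/seteqP; split => w /=.
      move=> [h1 h2] i _; split => /=; first exact: h1.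
      by case: ifPn => // iI; exact: h2.
    move=> h; split => i iI /=; have [] := h i (finset.in_setT i) => //= _.
    by rewrite iI.
  rewrite indep; last first.
    by move=> i; apply: measurableX => //; case: ifP.
  rewrite -prodEFin [X in (_ * X)%E]big_mkcond -big_split /=.
  apply: eq_big => [i|i _]; first by rewrite inE.
  rewrite /C; case: ifPn => iI /=.
    by rewrite -(hin i)//; congr (P _); apply/seteqP; split.
  rewrite -(@probability_setT _ _ _ Pout) -(hout i)//.
set c := \prod_(i < m) _ in key.
have c0 : 0 < c.
  by apply: prodr_gt0 => i _; case: ifP => _ //; rewrite subr_gt0.
have PL : P (labels_event I) = c%:E.
  have := key (fun=> setT) (fun=> measurableT).
  rewrite big1 => [|i _]; last exact: probability_setT.
  rewrite mule1 => <-; congr (P _).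
  by apply/seteqP; split => w /=; [move=> h; split | case].
rewrite cond_probE ?PL ?lt0e_neq0//; last by rewrite eqe gt_eqF.
by rewrite setIC key// muleAC -EFinM divff ?mul1e// gt_eqF.
Qed.

End huber.

Section filter.
Variables (R : realType) (m d : nat).

Definition midpoint_rule (mid : R -> R -> R) : Prop :=
  forall a b, a <= b -> a <= mid a b <= b.

(* mid is applied to the two middle order statistics, which coincide when the
   number of values is odd; midpoint_rule mid then forces mid a a = a. *)
Definition median (mid : R -> R -> R) (s : seq R) : R :=
  let t := sort <=%R s in
  mid (nth 0 t (size s).-1./2) (nth 0 t (size s)./2).

Definition EWM (mid : R -> R -> R) (G : 'I_m -> 'rV[R]_d) (S : {set 'I_m})
  : 'rV[R]_d := \row_j median mid [seq G i 0 j | i <- enum S].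

(* The norm `|v| of the library on row vectors is the sup norm. *)
Definition norm2 (v : 'rV[R]_d) : R := Num.sqrt (\sum_j v 0 j ^+ 2).

Definition ideal_filter (mid : R -> R -> R) (G : 'I_m -> 'rV[R]_d)
    (nabla : 'rV[R]_d) (I S : {set 'I_m}) : Prop :=
  #|S| = #|I| /\
  forall S' : {set 'I_m}, #|S'| = #|I| ->
    norm2 (EWM mid G S - nabla) <= norm2 (EWM mid G S' - nabla).

Definition err_in (I S : {set 'I_m}) : R := #|I :\: S|%:R / #|I|%:R.

End filter.

(* Main.v *)
(* Put q = 1 - p, s = sqrt (ln (2/delta) / (2m)). By Hoeffding's bound, applied
   to the binomial weights of the label sets, M_in >= m (q - s) fails with
   probability at most delta/2. Given the labels I, a Chernoff bound in each of
   the at most m d pairs (i, j) with i in I shows that some coordinate of an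
   in-distribution gradient is eps-far from that of the reference gradient with
   probability at most delta/2. Off these two events, every coordinate of
   EWM(G_I) lies within eps of the reference since a median lies between the
   extreme values, and S* does at least as well as I. Finally
   |I \ S*| = |S* \ I| <= m - M_in, and m / M_in <= 1 / (q - s) <=
   1 / q + 2 s / q^2 because 2 s <= q, which is the lower bound on m. *)
Require Import Defs.
From mathcomp Require Import ring lra.
Import numFieldNormedType.Exports.

Set Implicit Arguments.
Unset Strict Implicit.
Unset Printing Implicit Defensive.

(** * Hoeffding's bound for the weights of label sets *)

Section hoeffding.
Variable R : realType.

(** A nonnegative derivative makes [f] nondecreasing on the half-line. Applied twice below, it lifts
    a sign from a second derivative to the function. *)
Lemma is_derive_ge0 (f df : R -> R) :
  (forall x : R, is_derive x 1 f (df x)) -> 0 <= f 0 ->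
  (forall x, 0 <= x -> 0 <= df x) -> forall x, 0 <= x -> 0 <= f x.
Proof.
move=> fdf f0 df0 x x0; apply: (le_trans f0).
apply: (@ger0_derive1_ndecry _ f 0) => // [y|].
- by rewrite in_itv/= andbT => y0; rewrite derive1E derive_val df0// ltW.
- apply: derivable_within_continuous => y _; exact: ex_derive.
Qed.

(* Hoeffding's lemma for a Bernoulli variable, on the half-line that the upper
   tail needs: the difference of the logarithms vanishes to first order at 0 and
   has second derivative (1/2 - u)^2, where u is the tilted success rate. *)
Lemma bernoulli_mgf_le (p x : R) : 0 <= p < 1 -> 0 <= x ->
  1 - p + p * expR x <= expR (p * x + x ^+ 2 / 8).
Proof.
move=> /andP[p0 p1] x0.
pose D (y : R) : R := 1 - p + p * expR y.
have D0 y : 0 < D y.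
  by rewrite /D ltr_wpDr// ?subr_gt0// mulr_ge0// expR_ge0.
have dD (y : R) : is_derive y 1 D (p * expR y).
  have : is_derive y 1 (cst (1 - p) + p *: expR) (0 + p *: expR y).
    exact: is_deriveD.
  by rewrite add0r.
pose u (y : R) : R := p * expR y / D y.
have dlnD (y : R) : is_derive y 1 (@ln R \o D) (u y).
  rewrite /u mulrC; apply: is_derive1_comp; exact: is_derive1_ln.
have du (y : R) : is_derive y 1 u (u y * (1 - u y)).
  have h : is_derive y 1 (fun z => (D z)^-1) (- (D y) ^- 2 *: (p * expR y)).
    by apply: is_deriveV; rewrite gt_eqF.
  have : is_derive y 1 ((p *: expR) * (fun z => (D z)^-1))
     ((p * expR y) *: (- (D y) ^- 2 *: (p * expR y))
      + (D y)^-1 *: (p *: expR y)).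
    exact: is_deriveM.
  move=> H; apply: (is_derive_eq H); rewrite /u /GRing.scale/=.
  have : D y != 0 by rewrite gt_eqF.
  by move=> Dy; field.
have dg (y : R) :
    is_derive y 1 (fun z => z / 4 + p - u z) (4^-1 - u y * (1 - u y)).
  have : is_derive y 1 (4^-1 *: id + cst p - u)
     (4^-1 *: 1 + 0 - u y * (1 - u y)).
    exact: is_deriveB.
  rewrite addr0 /GRing.scale/= mulr1.
  congr (is_derive _ _ _ _); apply/funext => z /=.
  by rewrite /GRing.scale/= mulrC.
have g0 y : 0 <= y -> 0 <= y / 4 + p - u y.
  apply: (@is_derive_ge0 (fun z => z / 4 + p - u z) _ dg).
    by rewrite /u /D expR0 mulr1 subrK divr1; lra.
  move=> z _; rewrite (_ : _ - _ = (2^-1 - u z) ^+ 2) ?sqr_ge0//.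
  by field.
have df (y : R) : is_derive y 1 (fun z => z ^+ 2 / 8 + p * z - ln (D z))
    (y / 4 + p - u y).
  have sq : is_derive y 1 (8^-1 *: ((@id R) * id)) (8^-1 *: (y *: 1 + y *: 1)).
    exact: is_deriveZ.
  have lin : is_derive y 1 (8^-1 *: (id * id) + p *: id)
      (8^-1 *: (y *: 1 + y *: 1) + p *: 1).
    exact: is_deriveD.
  have := is_deriveB lin (dlnD y).
  congr (is_derive _ _ _ _); last by rewrite /GRing.scale/=; lra.
  apply/funext => z.
  change (8^-1 * z ^+ 2 + p * z - ln (D z) = z ^+ 2 / 8 + p * z - ln (D z)).
  by ring.
have := @is_derive_ge0 (fun z => z ^+ 2 / 8 + p * z - ln (D z)) _ df _ g0 x x0.
rewrite /D expR0 => /(_ _)H.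
have : 0 <= x ^+ 2 / 8 + p * x - ln (1 - p + p * expR x).
  by apply: H; rewrite mulr1 subrK ln1; lra.
by rewrite subr_ge0 -ler_expR lnK ?posrE ?(D0 x)// (addrC (p * x)).
Qed.

(** Expand the power as a product over [I]: [J] records the factors that contribute [a]. With
    [a = 1 - p] and [b = p] this is the generating function of the number of out-of-distribution
    samples. *)
Lemma sum_set_weight (I : finType) (a b z : R) :
  \sum_(J : {set I}) (\prod_(i : I) (if i \in J then a else b)) * z ^+ #|~: J|
  = (a + b * z) ^+ #|I|.
Proof.
rewrite -prodr_const (@bigA_distr R).
apply: eq_bigr => J _.
rewrite -prodr_const [X in _ * X]big_mkcond -big_split/=.
by apply: eq_bigr => i _; rewrite inE; case: ifP; rewrite /= ?mulr1.
Qed.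

(** Chernoff's method on the complement: a small [J] means [#|~: J| >= t], so the exponential weight
    is at least 1 on every summand kept. *)
Lemma binomial_lower_tail (I : finType) (p s : R) : 0 <= p < 1 -> 0 <= s ->
  \sum_(J : {set I} | #|J|%:R < #|I|%:R * (1 - p - s))
     \prod_(i : I) (if i \in J then 1 - p else p)
  <= expR (- (2 * #|I|%:R * s ^+ 2)).
Proof.
move=> p01 s0; set n := #|I|.
have w0 (J : {set I}) : 0 <= \prod_(i : I) (if i \in J then 1 - p else p).
  by apply: prodr_ge0 => i _; case: ifP => _; lra.
pose t : R := n%:R * (p + s).
(* 4 s minimizes the Chernoff exponent n (y^2 / 8 - y s) over y. *)
apply: (@le_trans _ _ (\sum_(J : {set I})
   (\prod_(i : I) (if i \in J then 1 - p else p)) * expR (4 * s) ^+ #|~: J|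
      * expR (- (4 * s * t)))).
  rewrite big_mkcond; apply: ler_sum => J _; case: ifPn => [Jlt|_]; last first.
    by rewrite !mulr_ge0// ?expR_ge0// exprn_ge0// expR_ge0.
  rewrite -mulrA ler_peMr// -expRM_natl -expRD -[leLHS]expR0 ler_expR.
  have JJ : #|J|%:R + #|~: J|%:R = n%:R :> R by rewrite -natrD cardsC.
  have tJ : t <= #|~: J|%:R by rewrite /t; lra.
  by rewrite subr_ge0 mulrC ler_wpM2r// mulr_ge0.
rewrite -mulr_suml sum_set_weight.
have H := @bernoulli_mgf_le p (4 * s) p01.
have : (1 - p + p * expR (4 * s)) ^+ n
    <= expR (n%:R * (p * (4 * s) + (4 * s) ^+ 2 / 8)).
  rewrite [leRHS]expRM_natl lerXn2r ?nnegrE ?expR_ge0 ?H ?mulr_ge0//.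
  by have := expR_ge0 (4 * s); nra.
move=> /ler_wpM2r -/(_ _ (expR_ge0 (- (4 * s * t)))) /le_trans; apply.
by rewrite -expRD ler_expR /t; nra.
Qed.

End hoeffding.

(** * Element-wise medians and the error of the filter *)

Section element_wise_median.
Variables (R : realType) (mid : R -> R -> R).
Hypothesis mid_rule : midpoint_rule mid.

(** Both middle order statistics are entries of [s], and [mid] stays between them. *)
Lemma median_between (s : seq R) (a b : R) : s != [::] ->
  (forall y, y \in s -> a <= y <= b) -> a <= median mid s <= b.
Proof.
move=> s0 sab; rewrite /median; set t := sort _ s.
have szs : (0 < size s)%N by rewrite lt0n size_eq0.
have tab k : (k < size s)%N -> a <= nth 0 t k <= b.
  by move=> ks; apply: sab; rewrite -(mem_sort <=%R) mem_nth// size_sort.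
have h1 : ((size s)./2 < size s)%N by rewrite -divn2 ltn_Pdiv.
have h2 : ((size s).-1./2 <= (size s)./2)%N by rewrite half_leq// leq_pred.
have /mid_rule/andP[l r] : nth 0 t (size s).-1./2 <= nth 0 t (size s)./2.
  have tsort : sorted <=%R t by exact: sort_le_sorted.
  by apply: (sorted_leq_nth le_trans le_refl) => //;
    rewrite inE size_sort// (leq_ltn_trans h2).
have /andP[al _] := tab _ (leq_ltn_trans h2 h1).
have /andP[_ rb] := tab _ h1.
by rewrite (le_trans al l) (le_trans r rb).
Qed.

Lemma norm2_le (d : nat) (v : 'rV[R]_d) (e : R) : 0 <= e ->
  (forall j, `|v 0 j| <= e) -> norm2 v <= e * Num.sqrt d%:R.
Proof.
move=> e0 ve; rewrite -[e in leRHS]ger0_norm// -sqrtr_sqr -sqrtrM ?sqr_ge0//.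
rewrite ler_wsqrtr// mulr_natr -[d in leRHS]card_ord -sumr_const.
by apply: ler_sum => j _; rewrite -real_normK ?num_real// lerXn2r ?nnegrE.
Qed.

Lemma norm2_EWM_le (m d : nat) (G : 'I_m -> 'rV[R]_d) (c : 'rV[R]_d)
    (e : R) (S : {set 'I_m}) : 0 <= e -> (0 < #|S|)%N ->
  (forall i j, i \in S -> `|G i 0 j - c 0 j| <= e) ->
  norm2 (EWM mid G S - c) <= e * Num.sqrt d%:R.
Proof.
move=> e0 S0 Ge; apply: norm2_le => // j; rewrite !mxE ler_distl.
apply: median_between => [|y /mapP[i]].
  by rewrite -size_eq0 size_map -cardE -lt0n.
by rewrite mem_enum => iS ->; rewrite -ler_distl Ge.
Qed.

Lemma err_in_le (m : nat) (I S : {set 'I_m}) (p s : R) : p < 1 -> (0 < m)%N ->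
  #|S| = #|I| -> 0 <= s -> 2 * s <= 1 - p -> m%:R * (1 - p - s) <= #|I|%:R ->
  err_in R I S <= 2 / (1 - p) ^+ 2 * s + p / (1 - p).
Proof.
move=> p1 m0 SI s0 sp mI; set q := 1 - p in sp mI *.
have q0 : 0 < q by rewrite subr_gt0.
have qs0 : 0 < q - s by lra.
have mR0 : 0 < m%:R :> R by rewrite ltr0n.
have I0 : 0 < #|I|%:R :> R by rewrite (lt_le_trans _ mI)// mulr_gt0.
have IS : #|I :\: S|%:R + #|I|%:R <= m%:R :> R.
  have -> : #|I :\: S| = #|S :\: I| by rewrite !cardsD SI finset.setIC.
  rewrite -natrD ler_nat -[leqRHS]card_ord -(cardsC I) addnC leq_add2l.
  apply: subset_leq_card; apply/fintype.subsetP => i.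
  by rewrite !inE => /andP[].
(* Adding 1 turns the error into a ratio bounded by [m / #|I|]. *)
have h : err_in R I S + 1 <= (q - s)^-1.
  have -> : err_in R I S + 1 = (#|I :\: S|%:R + #|I|%:R) / #|I|%:R.
    by rewrite /err_in; field; rewrite gt_eqF.
  rewrite ler_pdivrMr// mulrC ler_pdivlMr//.
  by rewrite (le_trans _ mI)// ler_wpM2r// ltW.
have k : (q - s)^-1 <= 2 / q ^+ 2 * s + q^-1.
  rewrite -[leLHS]mul1r ler_pdivrMr//.
  (* The excess over 1 is nonnegative because [0 <= s] and [2 * s <= q]. *)
  have -> : (2 / q ^+ 2 * s + q^-1) * (q - s) = 1 + s * (q - 2 * s) / q ^+ 2.
    by field; rewrite gt_eqF.
  by rewrite lerDl divr_ge0 ?sqr_ge0// mulr_ge0//; lra.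
have -> : p / q = q^-1 - 1 by rewrite /q; field; rewrite gt_eqF.
by lra.
Qed.

End element_wise_median.

(** * Union bound and sub-Gaussian tails *)

Section tails.
Context d (T : measurableType d) (R : realType).

Lemma measure_bigsetU_le (mu : {measure set T -> \bar R}) (I : Type) (r : seq I)
    (Q : pred I) (F : I -> set T) : (forall i, Q i -> measurable (F i)) ->
  (mu (\big[setU/set0]_(i <- r | Q i) F i) <= \sum_(i <- r | Q i) mu (F i))%E.
Proof.
move=> mF; elim: r => [|i r IH]; first by rewrite !big_nil measure0.
rewrite !big_cons; case: ifPn => // Qi.
apply: (le_trans (measureU2 _ _ _)); [exact: mF|exact: bigsetU_measurable|].
exact: leeD2l.
Qed.

Lemma sub_gaussian_tail (P : probability T R) (Y : T -> R) (v e : R) :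
  measurable_fun [set: T] Y -> 0 < v -> 0 < e -> sub_gaussian P Y v ->
  (P [set w | (e <= `|Y w|)%R] <= (2 * expR (- (e ^+ 2 / (2 * v))))%:E)%E.
Proof.
move=> mY v0 e0 Ysg.
(* [e / v] minimizes the Chernoff exponent [t ^+ 2 * v / 2 - t * e] over [t]. *)
have r0 : 0 < e / v by rewrite divr_gt0.
have tail (Z : T -> R) : measurable_fun [set: T] Z ->
    ('M_P Z (e / v) <= (expR ((e / v) ^+ 2 * v / 2))%:E)%E ->
    (P [set w | (e <= Z w)%R] <= (expR (- (e ^+ 2 / (2 * v))))%:E)%E.
  move=> mZ hZ; apply: (le_trans (chernoff (mfun_Sub (mem_set mZ)) _ r0)).
  apply: (@le_trans _ _
    ((expR ((e / v) ^+ 2 * v / 2))%:E * (expR (- (e / v * e)))%:E)%E).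
    by apply: lee_wpmul2r => //; rewrite lee_fin expR_ge0.
  rewrite -EFinM -expRD lee_fin ler_expR le_eqVlt; apply/orP; left; apply/eqP.
  by field; rewrite gt_eqF.
have -> : [set w | e <= `|Y w|]
    = [set w | e <= Y w] `|` [set w | e <= (\- Y) w].
  apply/seteqP; split => w /=; first by rewrite ler_normr => /orP.
  by move/orP; rewrite -ler_normr.
have mYN : measurable_fun [set: T] (\- Y).
  exact: measurable_realfun.measurable_funN.
have mge (Z : T -> R) :
    measurable_fun [set: T] Z -> measurable [set w | e <= Z w].
  move=> mZ; rewrite (_ : [set _ | _] = Z @^-1` `[e, +oo[).
    by rewrite -[X in measurable X]setTI; apply: mZ.
  by apply/seteqP; split => w /=; rewrite in_itv/= andbT.
apply: (le_trans (measureU2 _ (mge _ mY) (mge _ mYN))).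
have -> (z : R) : (2 * z)%:E = (z%:E + z%:E)%E.
  by rewrite -EFinD mulr_natl.
apply: leeD.
  exact: (tail Y mY (Ysg _)).
apply: (tail (\- Y) mYN).
(* The lower tail uses the moment bound at a negative parameter. *)
rewrite (_ : 'M_P (\- Y)%R (e / v) = 'M_P Y (- (e / v)))%E.
  by rewrite -[(e / v) ^+ 2]sqrrN; exact: Ysg.
by congr ('E_P[_])%E; apply/funext => w /=; rewrite mulrN mulNr.
Qed.

End tails.

(** * Probabilities of the label events *)

Section labels.
Context d (T : measurableType d) d' (X : measurableType d') (R : realType).
Variables (P : probability T R) (m : nat).
Variables (ood : 'I_m -> {RV P >-> bool}) (x : 'I_m -> {RV P >-> X}).
Variables (Pin Pout : probability X R) (p : R).
Hypothesis model : huber_model ood x Pin Pout p.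

Lemma labels_eventP (I : {set 'I_m}) :
  P (labels_event ood I)
  = (\prod_(i : 'I_m) (if i \in I then 1 - p else p))%:E.
Proof.
have [indep hin hout] := model.
have -> : labels_event ood I = \bigcap_(i in [set` [set: 'I_m]%SET])
     ((fun w => (ood i w, x i w)) @^-1` ([set i \notin I] `*` setT)).
  rewrite labels_eventE; apply/seteqP; split => w /= h i _.
    by split => //; exact: h.
  by have [] := h i (finset.in_setT i).
rewrite indep => [|i]; last exact: measurableX.
rewrite -prodEFin; apply: eq_big => [i|i _]; first by rewrite inE.
case: ifPn => iI.
  rewrite -[RHS]mule1 -(@probability_setT _ _ _ Pin) -(hin i)//.
rewrite -[RHS]mule1 -(@probability_setT _ _ _ Pout) -(hout i)//.
Qed.

(** Since [0 < p < 1], every label set has positive probability, so [given_labels] is a true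
    conditional law and not the default of [cond_prob]. *)
Lemma given_labelsE (I : {set 'I_m}) (B : set T) : 0 < p < 1 ->
  P (labels_event ood I `&` B)
  = (P (labels_event ood I) * given_labels ood I B)%E.
Proof.
move=> /andP[p0 p1].
have c0 : 0 < \prod_(i : 'I_m) (if i \in I then 1 - p else p).
  by apply: prodr_gt0 => i _; case: ifP => _ //; rewrite subr_gt0.
rewrite cond_probE labels_eventP; last by rewrite eqe gt_eqF.
move: (\prod_i _) c0 => c c0; rewrite setIC; move: (P _) => y /=.
by rewrite muleC -muleA -EFinM mulVf ?mule1// gt_eqF.
Qed.

End labels.

(** * Construction of the good event and conclusion *)

Theorem theorem4p2 (R : realType)
  (dT : measure_display) (T : measurableType dT) (P : probability T R)
  (dX : measure_display) (X : measurableType dX) (Pin Pout : probability X R)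
  (d m : nat) (p sigma delta : R) (nabla : 'rV[R]_d) (mid : R -> R -> R)
  (ood : 'I_m -> {RV P >-> bool}) (x : 'I_m -> {RV P >-> X})
  (grad : X -> 'rV[R]_d)
  (d_ge1 : (1 <= d)%N) (m_ge1 : (1 <= m)%N)
  (p01 : 0 < p < 1) (sigma_gt0 : 0 < sigma) (delta01 : 0 < delta < 1)
  (mid_rule : midpoint_rule mid)
  (model : huber_model ood x Pin Pout p)
  (grad_meas : forall j, measurable_fun [set: X] (fun y => grad y 0 j))
  (grad_subg : forall (I : {set 'I_m}) (i : 'I_m) (j : 'I_d), i \in I ->
     sub_gaussian (given_labels ood I)
       (fun w => grad (x i w) 0 j - nabla 0 j) (sigma ^+ 2))
  (m_large : 2 * ln (2 / delta) / (1 - p) ^+ 2 <= m%:R) :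
  let G w := fun i : 'I_m => grad (x i w) in
  let eps := sigma * Num.sqrt (2 * ln (4 * d%:R * m%:R / delta)) in
  exists E : set T,
    [/\ measurable E, ((1 - delta)%:E <= P E)%E &
        forall w, E w ->
          (0 < #|inD ood w|)%N /\
          forall S : {set 'I_m}, ideal_filter mid (G w) nabla (inD ood w) S ->
            err_in R (inD ood w) S
              <= 2 / (1 - p) ^+ 2 * Num.sqrt (ln (2 / delta) / (2 * m%:R))
                 + p / (1 - p)
            /\ norm2 (EWM mid (G w) S - nabla) <= eps * Num.sqrt d%:R].
Proof.
move=> G eps; set s := Num.sqrt (ln (2 / delta) / _).
have /andP[p0 p1] := p01; have /andP[delta0 delta1] := delta01.
have m0 : 0 < m%:R :> R by rewrite ltr0n.
have m1 : 1 <= m%:R :> R by rewrite ler1n.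
have d1 : 1 <= d%:R :> R by rewrite ler1n.
have L0 : 0 < ln (2 / delta) by rewrite ln_gt0// ltr_pdivlMr//; lra.
have s0 : 0 <= s by exact: sqrtr_ge0.
have s2 : s ^+ 2 = ln (2 / delta) / (2 * m%:R).
  by rewrite sqr_sqrtr// divr_ge0// ?ltW// mulr_gt0.
have sp : 2 * s <= 1 - p.
  rewrite -(@ler_pXn2r _ 2)// ?nnegrE ?mulr_ge0//; last by lra.
  rewrite exprMn s2; move: m_large; rewrite ler_pdivrMr ?exprn_gt0 ?subr_gt0//.
  move=> h; rewrite (_ : 2 ^+ 2 * _ = 2 * ln (2 / delta) / m%:R).
    by rewrite ler_pdivrMr// (mulrC (_ ^+ 2)).
  by field; rewrite gt_eqF.
have K1 : 1 < 4 * d%:R * m%:R / delta.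
  by rewrite ltr_pdivlMr// mul1r; nra.
have K0 : 0 < ln (4 * d%:R * m%:R / delta) by rewrite ln_gt0.
have eps0 : 0 < eps by rewrite mulr_gt0// sqrtr_gt0 mulr_gt0.
pose bad (ij : 'I_m * 'I_d) : set T :=
  [set w | eps <= `|G w ij.1 0 ij.2 - nabla 0 ij.2|].
have mY (i : 'I_m) (j : 'I_d) :
    measurable_fun [set: T] (fun w => grad (x i w) 0 j - nabla 0 j).
  apply: measurable_realfun.measurable_funB => //.
  exact: (measurableT_comp (grad_meas j)).
have mbad ij : measurable (bad ij).
  rewrite (_ : bad ij =
    (fun w => `|grad (x ij.1 w) 0 ij.2 - nabla 0 ij.2|) @^-1` `[eps, +oo[).
    rewrite -[X in measurable X]setTI.
    by apply: (measurableT_comp _ (mY ij.1 ij.2)).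
  by apply/seteqP; split => w /=; rewrite in_itv/= andbT.
(* [eps] is chosen so that [2 * expR (- (eps ^+ 2 / (2 * sigma ^+ 2)))] is exactly this value. *)
have bad_le (I : {set 'I_m}) ij : ij.1 \in I ->
    (given_labels ood I (bad ij) <= (delta / (2 * (d%:R * m%:R)))%:E)%E.
  move=> iI.
  have := sub_gaussian_tail (mY ij.1 ij.2) _ eps0 (grad_subg _ _ _ iI).
  move=> /(_ _)/le_trans; apply.
    by rewrite exprn_gt0.
  rewrite lee_fin /eps exprMn sqr_sqrtr ?mulr_ge0 ?(ltW K0)//.
  rewrite (_ : _ / (2 * sigma ^+ 2) = ln (4 * d%:R * m%:R / delta)).
    rewrite expRN lnK; last by rewrite posrE (lt_trans ltr01 K1).
    rewrite le_eqVlt; apply/orP; left; apply/eqP.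
    by field; rewrite !gt_eqF//; lra.
  by field; rewrite gt_eqF.
pose small (I : {set 'I_m}) := #|I|%:R < #|'I_m|%:R * (1 - p - s) :> R.
(* Failure is described separately for each label set: a small one fails outright, any other fails
   through a far gradient. *)
pose B (I : {set 'I_m}) : set T := if small I then setT else
  \big[setU/set0]_(ij : 'I_m * 'I_d | ij.1 \in I) bad ij.
have mB I : measurable (B I).
  rewrite /B; case: ifP => // _; exact: bigsetU_measurable.
pose F I := labels_event ood I `&` B I.
have mF I : measurable (F I).
  by apply: measurableI => //; exact: measurable_labels_event.
pose c (I : {set 'I_m}) : R := \prod_(i : 'I_m) (if i \in I then 1 - p else p).
have c0 I : 0 <= c I.
  by apply: prodr_ge0 => i _; case: ifP => _; lra.
(* The term [c I * (delta / 2)] is kept even for small [I], so that summing over all [I] only needs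
   the total mass of [c]. *)
have PF I :
    (P (F I) <= ((if small I then c I else 0) + c I * (delta / 2))%:E)%E.
  rewrite /F (given_labelsE model)// (labels_eventP model) -/(c I) /B.
  case: ifPn => _.
    by rewrite probability_setT mule1 lee_fin lerDl mulr_ge0// ltW// divr_gt0.
  rewrite add0r EFinM lee_wpmul2l ?lee_fin//.
  apply: (le_trans (measure_bigsetU_le _ _ _)) => [//|].
  apply: (@le_trans _ _
    (\sum_(ij : 'I_m * 'I_d | ij.1 \in I) (delta / (2 * (d%:R * m%:R)))%:E)%E).
    by apply: lee_sum => ij; exact: bad_le.
  rewrite sumEFin lee_fin.
  apply: (@le_trans _ _
    (\sum_(ij : 'I_m * 'I_d) (delta / (2 * (d%:R * m%:R))))).
    rewrite big_mkcond/=; apply: ler_sum => ij _; case: ifP => // _.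
    by rewrite divr_ge0 ?ltW// !mulr_gt0//; lra.
  rewrite sumr_const card_prod !card_ord -[_ *+ (_ * _)]mulr_natr natrM.
  rewrite le_eqVlt; apply/orP; left; apply/eqP.
  by field; rewrite !gt_eqF//; lra.
exists (~` \big[setU/set0]_(I : {set 'I_m}) F I); split.
- by apply: measurableC; exact: bigsetU_measurable.
- rewrite probability_setC; last exact: bigsetU_measurable.
  rewrite EFinB leeB//.
  apply: (le_trans (measure_bigsetU_le _ _ _)) => [//|].
  apply: (le_trans (lee_sum _ (fun I _ => PF I))).
  rewrite sumEFin lee_fin big_split/= -big_mkcond/= -mulr_suml.
  (* The generating function at [z = 1]. *)
  have -> : \sum_I c I = 1.
    have := sum_set_weight 'I_m (1 - p) p 1.
    rewrite mulr1 subrK expr1n => <-; apply: eq_bigr => I _.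
    by rewrite expr1n mulr1.
  have := @binomial_lower_tail R 'I_m p s.
  rewrite ltW// p1 => /(_ isT s0) tail.
  (* This equality dictates the value of [s]. *)
  have : expR (- (2 * #|'I_m|%:R * s ^+ 2)) = delta / 2.
    rewrite s2 card_ord (_ : 2 * m%:R * _ = ln (2 / delta)); last first.
      by field; rewrite gt_eqF.
    by rewrite expRN lnK ?posrE ?divr_gt0// invf_div.
  move: tail; rewrite /small /c; lra.
- move=> w Ew.
  have : ~ F (inD ood w) w.
    move=> Fw; apply: Ew; rewrite -bigcup_seq.
    by exists (inD ood w); rewrite /= ?mem_index_enum.
  rewrite /F /B => nF.
  have : ~~ small (inD ood w) by apply/negP => sm; apply: nF; rewrite sm.
  move=> nsm; rewrite (negbTE nsm) in nF.
  have mI : m%:R * (1 - p - s) <= #|inD ood w|%:R.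
    by move: nsm; rewrite /small card_ord -leNgt.
  (* [2 * s <= 1 - p] and [p < 1] give [0 < 1 - p - s]. *)
  have I0 : (0 < #|inD ood w|)%N.
    by rewrite -(ltr_nat R) (lt_le_trans _ mI)// mulr_gt0//; lra.
  split => // S [cS minS]; split; first exact: err_in_le.
  (* The competitor of [S] is the true in-distribution set itself. *)
  apply: (le_trans (minS _ erefl)); apply: norm2_EWM_le => //; first exact: ltW.
  move=> i j iI; rewrite leNgt; apply/negP => /ltW lt.
  apply: nF; split => //.
  by rewrite -bigcup_seq_cond; exists (i, j); rewrite /= ?mem_index_enum.
Qed.
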